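(* Let $k>0$, $\sigma>0$ and let $W\sim\text{Weibull}(k,\sigma)$. For $l\in\{0,1,2,3\}$ and $u\in\mathbb{R}$ write $M_{0,1}^{l}(u) = \mathbf{E}\left[W^{l}\, I\{W\leq u\}\right]$. Then $$M_{0,1}^{0}(u) = \begin{cases} 0, & u\leq 0,\\ 1-\exp\left(-(u/\sigma)^{k}\right), & u>0,\end{cases}$$ and, for $l=1,2,3$, $$M_{0,1}^{l}(u) = \begin{cases} 0, & u\leq 0,\\ \dfrac{l\sigma^{l}}{k}\,\Gamma\left(l/k;(u/\sigma)^{k}\right) - u^{l}\exp\left(-(u/\sigma)^{k}\right), & u>0.\end{cases}$$
   Context: $I\{\cdot\}$ is the indicator function. $\text{Weibull}(k,\sigma)$, with shape $k>0$ and scale $\sigma>0$, is the distribution on $[0,\infty)$ with $\mathbf{P}\{W\leq\alpha\} = 1-\exp(-(\alpha/\sigma)^{k})$ for $\alpha\geq 0$. $\Gamma(a;v) = \int_{0}^{v}e^{-t}t^{a-1}\,dt$ is the unnormalized (lower) incomplete Gamma function, for $a>0$, $v\geq 0$. *)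

(* Defs.v *)
From HB Require Import structures.
From mathcomp Require Import all_boot all_order all_algebra.
From mathcomp Require Import all_classical all_reals all_analysis.

Set Implicit Arguments.
Unset Strict Implicit.
Unset Printing Implicit Defensive.

Import Order.TTheory GRing.Theory Num.Theory.
Import numFieldNormedType.Exports.

Local Open Scope classical_set_scope.
Local Open Scope ring_scope.

(* The value of the cdf on the negative half-line is not prescribed: it is
   forced by the concentration of the law on [0, +oo). *)
Definition weibull_rv (d : measure_display) (T : measurableType d)
    (R : realType) (P : probability T R) (k sigma : R)
    (W : {RV P >-> R}) : Prop :=
  distribution P W `[0, +oo[ = 1%E /\
  forall alpha : R, 0 <= alpha ->
    cdf W alpha = (1 - expR (- ((alpha / sigma) `^ k)))%:E.

(* The unnormalized lower incomplete Gamma function, meaningful for 0 < a and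
   0 <= v.  For a < 1 the integrand is unbounded near 0 but still Lebesgue
   integrable; its value at the endpoint 0 (where powR is total) is
   irrelevant. *)
Definition lower_incomplete_gamma (R : realType) (a v : R) : R :=
  \int[lebesgue_measure]_(t in `[0, v]) (expR (- t) * t `^ (a - 1)).

(* E[W^l I{W <= u}], as an extended real; W^0 = 1, including where W = 0. *)
Definition truncated_moment (d : measure_display) (T : measurableType d)
    (R : realType) (P : probability T R) (W : {RV P >-> R})
    (l : nat) (u : R) : \bar R :=
  'E_P[fun w => W w ^+ l * \1_[set w | W w <= u] w].

(* Main.v *)
Require Import Defs.
From HB Require Import structures.
From mathcomp Require Import all_boot all_order all_algebra.
From mathcomp Require Import all_classical all_reals all_analysis.
From mathcomp Require Import measurable_realfun ring.

Import Order.TTheory GRing.Theory Num.Theory.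
Import numFieldNormedType.Exports.

Local Open Scope classical_set_scope.
Local Open Scope ring_scope.

(** Since W is nonnegative almost surely, the tail formula for the expectation
    of W^l I{0 < W <= u} writes the truncated moment as the integral over
    [0, u^l] of F(u) - F(s^(1/l)), F being the cdf of W.  No density is
    needed: the constant part of F(u) - F(s^(1/l)) contributes the boundary
    term - u^l exp(-(u/sigma)^k), and the substitution s = sigma^l t^(l/k)
    turns the rest into the incomplete Gamma function. *)

(** * Substitution with a derivative unbounded at the left endpoint *)

(* [F^`()] may be unbounded near [a], as with [F t = c * t `^ p] for [p < 1]:
   the substitution is done on [`[a + (b - a) / n.+1, b]], then [n] goes to
   infinity. *)
Lemma increasing_ge0_integration_by_substitution_oc (R : realType)
    (F G : R -> R) (a b : R) : a < b ->
  {in `[a, b] &, {homo F : x y / x < y}} ->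
  {in `]a, b], forall x, derivable F x 1} ->
  {in `]a, b], continuous F^`()%classic} ->
  {in `]a, b], forall x, 0 <= F^`()%classic x} ->
  F x @[x --> a^'+] --> F a ->
  {in `]F a, F b], continuous G} ->
  {in `]F a, F b], forall x, 0 <= G x} ->
  (\int[lebesgue_measure]_(x in `]F a, F b]) (G x)%:E =
   \int[lebesgue_measure]_(x in `]a, b]) (((G \o F) * F^`()%classic) x)%:E)%E.
Proof.
move=> ab incrF dF cF' F'0 Fa cG G0.
pose s n : R := a + (b - a) / n.+1%:R.
have bDa_gt0 : 0 < b - a by rewrite subr_gt0.
have s_gt n : a < s n by rewrite ltrDl divr_gt0.
have s_le n : s n <= b.
  by rewrite -lerBrDl ler_pdivrMr ?ltr0n// ler_peMr ?ler1n// ltW.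
have s_in n : s n \in `[a, b] by rewrite in_itv/= ltW//=.
have s_cvg : s n @[n --> \oo] --> a.
  rewrite -[X in _ --> X]addr0; apply: cvgD; first exact: cvg_cst.
  rewrite -(mulr0 (b - a)); apply: cvgM; first exact: cvg_cst.
  exact: cvg_harmonic.
have sub_ab n x : x \in `[s n, b] -> x \in `]a, b].
  by rewrite !in_itv/= => /andP[sx ->]; rewrite (lt_le_trans (s_gt n)).
have aF n : F a < F (s n) by apply: incrF => //; rewrite in_itv/= lexx ltW.
have leF : {in `[a, b] &, {homo F : x y / x <= y}}.
  move=> x y xab yab; rewrite le_eqVlt => /predU1P[->//|xy].
  exact/ltW/incrF.
have b_in : b \in `[a, b] by rewrite in_itv/= lexx ltW.
have sub_F n x : x \in `[F (s n), F b] -> x \in `]F a, F b].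
  by rewrite !in_itv/= => /andP[sx ->]; rewrite (lt_le_trans (aF n)).
have F_in x : x \in `]a, b] -> F x \in `]F a, F b].
  rewrite !in_itv/= => /andP[ax xb]; rewrite incrF ?leF//.
  - by rewrite in_itv/= ltW.
  - by rewrite in_itv/= lexx ltW.
  - by rewrite in_itv/= ltW.
have cGn n : {within `[F (s n), F b], continuous G}.
  by apply: continuous_in_subspaceT => x /[1!inE] /sub_F /cG.
have cF x : x \in `]a, b] -> {for x, continuous F}.
  by move=> /dF /derivable1_diffP /differentiable_continuous.
have cGFF' x : x \in `]a, b] -> {for x, continuous ((G \o F) * F^`()%classic)}.
  move=> xab; apply: continuousM; last exact: cF'.
  by apply: continuous_comp; [exact: cF | exact/cG/F_in].
have substn n : (\int[lebesgue_measure]_(x in `[F (s n), F b]) (G x)%:E =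
   \int[lebesgue_measure]_(x in `[s n, b]) (((G \o F) * F^`()%classic) x)%:E)%E.
  apply: integration_by_substitution_increasing => //.
  - move=> x y /sub_ab + /sub_ab.
    by move=> /subset_itv_oc_cc xab /subset_itv_oc_cc yab; exact: incrF.
  - by move=> x /subset_itv_oo_cc /sub_ab /cF'.
  (* The one-sided limits at both ends of [[s n, b]] come from two-sided continuity of the
     derivative on []a, b]], which contains [s n] and [b]. *)
  - apply/cvg_ex; exists (F^`()%classic (s n)); apply: cvg_at_right_filter.
    by apply: cF'; apply: (sub_ab n); rewrite in_itv/= lexx s_le.
  - apply/cvg_ex; exists (F^`()%classic b); apply: cvg_at_left_filter.
    by apply: cF'; rewrite in_itv/= lexx ab.
  - split.
    + by move=> x /subset_itv_oo_cc /sub_ab /dF.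
    + apply: cvg_at_right_filter; apply: cF.
      by apply: (sub_ab n); rewrite in_itv/= lexx s_le.
    + by apply: cvg_at_left_filter; apply: cF; rewrite in_itv/= lexx ab.
have s_nincr m n : (m <= n)%N -> s n <= s m.
  move=> mn; rewrite lerD2l ler_pM2l// lef_pV2 ?posrE ?ltr0n//.
  by rewrite ler_nat.
have bigcup_s : \bigcup_n `[s n, b]%classic = `]a, b]%classic.
  apply/seteqP; split => [x [n _] /=|x /= xab]; first exact: sub_ab.
  have /andP[ax xb] : a < x <= b by move: xab; rewrite in_itv.
  have [n _ /(_ n (leqnn n)) snx] : \forall n \near \oo, s n < x.
    exact: (cvgr_lt a).
  by exists n => //=; rewrite in_itv/= xb ltW.
(* Right-continuity of [F] at [a] is what makes the images exhaust []F a, F b]]: no gap is left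
   above [F a]. *)
have bigcup_Fs : \bigcup_n `[F (s n), F b]%classic = `]F a, F b]%classic.
  apply/seteqP; split => [x [n _] /=|x /= xab]; first exact: sub_F.
  have /andP[ax xb] : F a < x <= F b by move: xab; rewrite in_itv.
  have Fs_cvg : F (s n) @[n --> \oo] --> F a.
    by have /cvg_at_rightP := Fa; apply; split.
  have [n _ /(_ n (leqnn n)) snx] : \forall n \near \oo, F (s n) < x.
    exact: (cvgr_lt (F a)).
  by exists n => //=; rewrite in_itv/= xb ltW.
rewrite -bigcup_s -bigcup_Fs.
(* Both integrals are limits of the same sequence, by monotone convergence along the growing
   intervals; nonnegativity of [G] and of the derivative of [F] enters here. *)
have cvgG : (\int[lebesgue_measure]_(x in `[F (s n), F b]) (G x)%:E
    @[n --> \oo] -->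
    \int[lebesgue_measure]_(x in \bigcup_n `[F (s n), F b]%classic) (G x)%:E)%E.
  apply: ge0_nondecreasing_set_cvg_integral => //.
  - move=> m n mn; apply/subsetPset => x /=; rewrite !in_itv/= => /andP[+ ->].
    by move/(le_trans _) => ->//; apply: leF => //; exact: s_nincr.
  - move=> n; apply/measurable_EFinP.
    by apply: subspace_continuous_measurable_fun.
  - by move=> n x /sub_F xab; rewrite lee_fin G0.
apply: (cvg_unique _ cvgG) => //.
rewrite /=; under eq_cvg do rewrite substn.
apply: ge0_nondecreasing_set_cvg_integral => //.
- move=> m n mn; apply/subsetPset => x /=; rewrite !in_itv/= => /andP[+ ->].
  by move/(le_trans _) => ->//; exact: s_nincr.
- move=> n; apply/measurable_EFinP.
  apply: subspace_continuous_measurable_fun => //.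
  by apply: continuous_in_subspaceT => x /[1!inE] /sub_ab /cGFF'.
- by move=> n x /sub_ab xab; rewrite lee_fin mulr_ge0 ?F'0//; exact/G0/F_in.
Qed.

(** * Truncated moments through tail probabilities *)

Lemma distribution_itv_oc (d : measure_display) (T : measurableType d)
    (R : realType) (P : probability T R) (W : {RV P >-> R}) (a b : R) :
  a <= b -> (distribution P W `]a, b] = cdf W b - cdf W a)%E.
Proof.
move=> ab; rewrite /cdf -[X in (_ - distribution P W X)%E](setIidr
    (_ : `]-oo, a] `<=` `]-oo, b]%classic)); last exact: subitvPr.
rewrite -measureD//; last by rewrite ltey_eq fin_num_measure.
congr (distribution P W _); apply/seteqP; split=> x /=; rewrite !in_itv/=.
  by move=> /andP[ax ->]; split => //; apply/negP; rewrite -ltNge.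
by move=> [-> /negP]; rewrite -ltNge => ->.
Qed.

(** The event W < 0 is null, and at W = 0 the factor W^l vanishes because [0 < l]. The new integrand
    is nonnegative everywhere, not just almost surely, as the tail formula requires. *)
Lemma truncated_moment_itv_oc (d : measure_display) (T : measurableType d)
    (R : realType) (P : probability T R) (W : {RV P >-> R})
    (W_ge0 : distribution P W `[0, +oo[ = 1%E) (l : nat) (u : R) :
  (0 < l)%N ->
  (truncated_moment W l u =
   'E_P[(fun w => W w ^+ l * \1_(W @^-1` `]0, u]) w)%R])%E.
Proof.
move=> l_gt0; rewrite /truncated_moment unlock.
have mle : measurable [set w | W w <= u].
  have := @measurable_funPTI _ _ _ _ W `]-oo, u]%classic (measurable_itv _).
  by rewrite set_itvNyc.
have mWl A : measurable A -> measurable_fun setT (fun w => W w ^+ l * \1_A w).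
  move=> mA; apply: measurable_funM; first exact: measurable_funX.
  exact: measurable_indic.
apply: ae_eq_integral => //.
- by apply/measurable_EFinP; exact: mWl.
- by apply/measurable_EFinP; apply: mWl; exact: measurable_funPTI.
- exists (~` (W @^-1` `[0, +oo[)); split.
  + by apply: measurableC; exact: measurable_funPTI.
  + transitivity (1 - distribution P W `[0%R, +oo[)%E.
      by apply: probability_setC; exact: measurable_funPTI.
    by rewrite W_ge0 subee.
  + apply: subsetC => w /=; rewrite in_itv/= andbT => W0 _.
    move: W0; rewrite le_eqVlt => /predU1P[W0|W0].
      by rewrite -W0 expr0n gtn_eqF//= !mul0r.
    congr (_ * _)%:E; rewrite !indicE; congr (_%:R).
    by congr nat_of_bool; apply/idP/idP; rewrite !inE/= in_itv/= W0.
Qed.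

(** For s >= 0 the variable W^l I{0 < W <= u} exceeds s exactly when s^(1/l) < W <= u, an event of
    probability F(u) - F(s^(1/l)), and empty once s > u^l. *)
Lemma truncated_moment_ge0_tail (d : measure_display) (T : measurableType d)
    (R : realType) (P : probability T R) (W : {RV P >-> R})
    (W_ge0 : distribution P W `[0, +oo[ = 1%E) (l : nat) (u : R) :
  (0 < l)%N -> 0 <= u ->
  (truncated_moment W l u =
   \int[lebesgue_measure]_(s in `[0%R, (u ^+ l)%R])
     (cdf W u - cdf W (s `^ l%:R^-1)))%E.
Proof.
move=> l_gt0 u_ge0.
have mA : measurable (W @^-1` `]0, u]) by exact: measurable_funPTI.
pose X w := W w ^+ l * \1_(W @^-1` `]0, u]) w.
have mX : measurable_fun setT X.
  apply: measurable_funM; first exact: measurable_funX.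
  exact: measurable_indic.
pose XRV : {RV P >-> R} := HB.pack X (isMeasurableFun.Build _ _ _ _ X mX).
have X_ge0 w : 0 <= X w.
  rewrite /X indicE; have [|_] := boolP (w \in _); last by rewrite mulr0.
  by rewrite mulr1 inE/= in_itv/= => /andP[/ltW W0 _]; rewrite exprn_ge0.
rewrite truncated_moment_itv_oc//.
rewrite -[LHS]/('E_P[XRV])%E ge0_expectation_ccdf//.
(* The tail formula integrates over [[0, +oo[], so the right side is extended by zero beyond u^l and
   the integrands are compared pointwise. *)
rewrite (_ : `[0, u ^+ l]%classic = `[0, +oo[ `&` `[0, u ^+ l]); last first.
  by apply/esym/setIidr; exact: subitvPr.
rewrite [RHS]integral_mkcondr; apply: eq_integral => s.
rewrite inE/= in_itv/= andbT => s_ge0.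
have rootK (x : R) : 0 <= x -> (x `^ l%:R^-1) ^+ l = x.
  move=> x0; rewrite -powR_mulrn ?powR_ge0// -powRrM mulVf ?powRr1//.
  by rewrite pnatr_eq0 -lt0n.
have XE : XRV @^-1` `]s, +oo[ = W @^-1` `]s `^ l%:R^-1, u].
  apply/seteqP; split => w /=; rewrite !in_itv/= andbT /X indicE.
    have [|_] := boolP (w \in _); last by rewrite mulr0 ltNge s_ge0.
    rewrite inE/= in_itv/= mulr1 => /andP[W0 ->]; rewrite andbT.
    rewrite -[X in X < _ -> _](rootK s)// ltr_pXn2r ?nnegrE ?powR_ge0//.
    exact: ltW.
  move=> /andP[sW Wu].
  have W0 : 0 < W w by rewrite (le_lt_trans _ sW) ?powR_ge0.
  rewrite mem_set ?mulr1/= ?in_itv/= ?W0//.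
  by rewrite -(rootK s)// ltr_pXn2r ?nnegrE ?powR_ge0// ltW.
rewrite /ccdf /distribution /pushforward XE patchE.
have [su|su] := leP (s `^ l%:R^-1) u.
  rewrite mem_set /=; last first.
    by rewrite in_itv/= s_ge0 -[leLHS]rootK// lerXn2r ?nnegrE ?powR_ge0.
  by rewrite -distribution_itv_oc.
rewrite memNset /=; last first.
  rewrite in_itv/= s_ge0/=; apply/negP; rewrite -ltNge.
  by rewrite -[ltRHS]rootK// ltrXn2r ?gtn_eqF.
rewrite set_itv_ge ?preimage_set0 ?measure0//.
by rewrite bnd_simp -leNgt ltW.
Qed.

(** * Reduction to the incomplete Gamma function *)

(** Substituting s = c t^a gives (s / c)^(1/a) = t and ds = c a t^(a - 1) dt, which produces the
    Gamma integrand. *)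
Lemma integral_expRN_powR (R : realType) (c a v : R) :
    0 < c -> 0 < a -> 0 < v ->
  (\int[lebesgue_measure]_(s in `[0%R, (c * v `^ a)%R])
     (expR (- ((s / c) `^ a^-1)))%:E =
   (c * a * lower_incomplete_gamma a v)%:E)%E.
Proof.
move=> c_gt0 a_gt0 v_gt0.
pose F (t : R) : R := c * t `^ a.
pose G (s : R) : R := expR (- ((s / c) `^ a^-1)).
have F0 : F 0 = 0 by rewrite /F powR0 ?mulr0 ?gt_eqF.
have is_dF (t : R) : 0 < t -> is_derive t 1 F (c * (a * t `^ (a - 1))).
  by move=> t_gt0; apply: is_deriveZ; exact: is_derive1_powR.
have dFE (t : R) : 0 < t -> F^`()%classic t = c * (a * t `^ (a - 1)).
  by move=> /is_dF dF; rewrite derive1E derive_val.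
have mexp (A : set R) :
    measurable_fun A (fun t => (expR (- t) * t `^ (a - 1))%:E).
  apply/measurable_EFinP; apply: measurable_funM.
    by apply: measurableT_comp => //; exact: measurable_funN.
  exact: measurable_funTS.
have mG (A : set R) : measurable_fun A (EFin \o G).
  apply/measurable_EFinP; apply: measurableT_comp => //.
  apply: measurable_funN; apply: measurable_funTS.
  by apply: (measurableT_comp (measurable_powR _)); exact: measurable_funM.
have substG : (\int[lebesgue_measure]_(s in `[0%R, F v]) (G s)%:E =
    (c * a)%:E *
    \int[lebesgue_measure]_(t in `[0%R, v]) (expR (- t) * t `^ (a - 1))%:E)%E.
  (* The endpoint 0 is dropped on both sides, as a null set: for a < 1 the derivative of [F] blows
     up there. *)
  rewrite -integral_itv_obnd_cbnd; last exact: mG.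
  rewrite -{1}F0 increasing_ge0_integration_by_substitution_oc//.
  - rewrite -integral_itv_obnd_cbnd; last exact: mexp.
    rewrite -ge0_integralZl_EFin//; last 3 first.
    + by move=> t _; rewrite lee_fin mulr_ge0 ?expR_ge0 ?powR_ge0.
    + exact: mexp.
    + by rewrite mulr_ge0 ?ltW.
    apply: eq_integral => t; rewrite inE/= in_itv/= => /andP[t_gt0 _].
    rewrite -EFinM; congr EFin; rewrite fctE /= dFE// /G /F.
    rewrite [c * _]mulrC mulfK ?gt_eqF// -powRrM mulfV ?gt_eqF// powRr1 ?ltW//.
    by rewrite mulrCA -[RHS]mulrA; congr (c * _); exact: mulrCA.
  - move=> s t; rewrite !in_itv/= => /andP[s0 _] /andP[t0 _] st.
    by rewrite ltr_pM2l// gt0_ltr_powR.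
  - by move=> t; rewrite in_itv/= => /andP[/is_dF[]].
  - move=> t; rewrite in_itv/= => /andP[t_gt0 _].
    have : {for t, continuous (fun t => c * (a * t `^ (a - 1)))}.
      apply: continuousM; first exact: cst_continuous.
      apply: continuousM; first exact: cst_continuous.
      apply: differentiable_continuous; apply/derivable1_diffP.
      by apply: derivable_powR; rewrite in_itv/= t_gt0.
    (* [dFE] holds at positive points only; these form a neighbourhood of [t], so continuity of the
       closed form transfers. *)
    rewrite /prop_for /continuous_at dFE//; apply: cvg_trans.
    by apply: near_eq_cvg; near=> x; rewrite dFE//; near: x; exact: lt_nbhsr.
  - move=> t; rewrite in_itv/= => /andP[t_gt0 _].
    by rewrite dFE// !mulr_ge0 ?powR_ge0 ?ltW.
  - rewrite F0 -[X in _ --> X](mulr0 c); apply: cvgM; first exact: cvg_cst.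
    exact: powR_cvg0.
  - move=> s; rewrite F0 in_itv/= => /andP[s_gt0 _].
    have powR_cts : {for s / c, continuous (fun x : R => x `^ a^-1)}.
      apply: differentiable_continuous; apply/derivable1_diffP.
      by apply: derivable_powR; rewrite in_itv/= divr_gt0.
    apply: continuous_comp; last exact: continuous_expR.
    apply: continuousN.
    exact: (continuous_comp (@mulrr_continuous _ c^-1 s) powR_cts).
  - by move=> s _; exact: expR_ge0.
have int_ge0 :
    (0 <= \int[lebesgue_measure]_(t in `[0%R, v])
            (expR (- t) * t `^ (a - 1))%:E)%E.
  by apply: integral_ge0 => t _; rewrite lee_fin mulr_ge0 ?expR_ge0 ?powR_ge0.
have ca_gt0 : 0 < c * a by rewrite mulr_gt0.
(* [lower_incomplete_gamma] is a real number obtained by [fine], so its integral must be shown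
   finite. Multiplied by [c * a] it equals the integral of [G], which is at most 1, over a bounded
   interval. *)
rewrite substG [in RHS]EFinM /lower_incomplete_gamma /Rintegral fineK// ge0_fin_numE//.
rewrite -(@lte_pmul2l _ (c * a)%:E)// -substG mulry gtr0_sg// mul1e.
apply: (@le_lt_trans _ _
    (\int[lebesgue_measure]_(s in `[0%R, F v]) (cst 1%E) s)%E).
  apply: ge0_le_integral => //.
  - by move=> s _; rewrite lee_fin expR_ge0.
  - exact: mG.
  - by move=> s _; rewrite lee_fin -expR0 ler_expR oppr_le0 powR_ge0.
rewrite integral_cst//= mul1e lebesgue_measure_itv/=.
by case: ifP => _; rewrite ?ltry// -EFinB ltry.
Unshelve. all: by end_near. Qed.

(** * Moments of the Weibull law *)

Theorem proposition8 (d : measure_display) (T : measurableType d)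
    (R : realType) (P : probability T R) (k sigma : R)
    (k_gt0 : 0 < k) (sigma_gt0 : 0 < sigma)
    (W : {RV P >-> R}) (W_weibull : weibull_rv k sigma W) :
  (forall u : R,
     truncated_moment W 0 u =
       (if u <= 0 then 0 else 1 - expR (- ((u / sigma) `^ k)))%:E) /\
  (forall (l : nat) (u : R), (1 <= l <= 3)%N ->
     truncated_moment W l u =
       (if u <= 0 then 0
        else l%:R * sigma ^+ l / k
               * lower_incomplete_gamma (l%:R / k) ((u / sigma) `^ k)
             - u ^+ l * expR (- ((u / sigma) `^ k)))%:E).
Proof.
have [W_ge0 W_cdf] := W_weibull.
(* The prescribed formula gives F(0) = 0, and monotonicity carries this to the negative
   half-line. *)
have cdf0 u : u <= 0 -> cdf W u = 0%E.
  move=> u_le0; apply/eqP; rewrite eq_le cdf_ge0 andbT.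
  rewrite (le_trans (cdf_nondecreasing W u_le0))// W_cdf//.
  by rewrite mul0r powR0 ?gt_eqF// oppr0 expR0 subrr.
split=> [u|l u /andP[l_gt0 _]].
  rewrite /truncated_moment.
  under eq_fun do rewrite expr0 mul1r.
  have mle : measurable [set w | W w <= u].
    by have := @measurable_funPTI _ _ _ _ W `]-oo, u]%classic (measurable_itv _);
      rewrite set_itvNyc.
  rewrite expectation_indic//.
  have -> : P [set w | W w <= u] = cdf W u.
    by rewrite /cdf set_itvNyc.
  case: (leP u 0) => [/cdf0//|/ltW u_ge0]; exact: W_cdf.
case: (leP u 0) => [u_le0|u_gt0].
  rewrite truncated_moment_itv_oc// unlock integral0_eq// => w _.
  by rewrite set_itv_ge ?preimage_set0 ?indic0 ?mulr0// bnd_simp -leNgt.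
rewrite truncated_moment_ge0_tail ?ltW//.
set E := expR (- ((u / sigma) `^ k)).
have l0 : 0 < l%:R :> R by rewrite ltr0n.
(* [G] is the survival function of W^l, which is Weibull with shape k/l and scale sigma^l; the shape
   is written as the inverse of l/k to match [integral_expRN_powR] with a = l/k. *)
pose G (s : R) := expR (- ((s / sigma ^+ l) `^ (l%:R / k)^-1)).
have cdfG s : 0 <= s -> cdf W (s `^ l%:R^-1) = (1 - G s)%:E.
  move=> s_ge0; rewrite W_cdf ?powR_ge0//; congr ((1 - expR (- _))%:E).
  have sl_gt0 : 0 < sigma ^+ l by rewrite exprn_gt0.
  have r_ge0 : 0 <= s / sigma ^+ l by rewrite divr_ge0// ltW.
  rewrite -[in LHS](@divfK _ (sigma ^+ l) _ s) ?gt_eqF//.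
  rewrite [(_ * sigma ^+ l) `^ _]powRM ?(ltW sl_gt0)// -(powR_mulrn l (ltW sigma_gt0)).
  rewrite -[sigma `^ _ `^ _]powRrM mulfV ?gt_eqF// powRr1 ?(ltW sigma_gt0)//.
  rewrite mulfK ?gt_eqF// -powRrM powR_mulrn ?(ltW sigma_gt0)//.
  by rewrite invf_div [k / _]mulrC.
have mG (A : set R) : measurable_fun A (EFin \o G).
  apply/measurable_EFinP; apply: measurableT_comp => //.
  apply: measurable_funN; apply: measurable_funTS.
  by apply: (measurableT_comp (measurable_powR _)); exact: measurable_funM.
(* With c = sigma^l, a = l/k and v = (u/sigma)^k, the upper bound c v^a is u^l. *)
have uE : sigma ^+ l * ((u / sigma) `^ k) `^ (l%:R / k) = u ^+ l.
  rewrite -powRrM mulrCA mulfV ?gt_eqF// mulr1 powR_mulrn ?divr_ge0 ?ltW//.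
  by rewrite -exprMn mulrC divfK ?gt_eqF.
have intG := @integral_expRN_powR R (sigma ^+ l) (l%:R / k) ((u / sigma) `^ k).
rewrite uE in intG.
(* Pointwise F(u) - F(s^(1/l)) = G(s) - E. Adding the constant E, of integral u^l E, instead of
   subtracting it keeps every integrand nonnegative; the finite term is cancelled afterwards. *)
have intE : (\int[lebesgue_measure]_(s in `[0%R, (u ^+ l)%R])
     (cdf W u - cdf W (s `^ l%:R^-1)) + (u ^+ l * E)%:E =
   \int[lebesgue_measure]_(s in `[0%R, (u ^+ l)%R]) (G s)%:E)%E.
  rewrite EFinM muleC (_ : (u ^+ l)%:E =
    lebesgue_measure (`[0, u ^+ l]%classic : set R)); last first.
    by rewrite lebesgue_measure_itv/= lte_fin exprn_gt0// oppr0 adde0.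
  rewrite -integral_cst// -ge0_integralD//=.
  - apply: eq_integral => s; rewrite inE/= in_itv/= => /andP[s_ge0 _].
    by rewrite cdfG// W_cdf ?ltW// -!EFinD; congr EFin; rewrite /E; ring.
  - move=> s; rewrite in_itv/= => /andP[s_ge0 su].
    rewrite sube_ge0 ?fin_num_measure//; apply: (cdf_nondecreasing W).
    have -> : u = (u ^+ l) `^ l%:R^-1.
      by rewrite -powR_mulrn ?ltW// -powRrM mulfV ?gt_eqF// powRr1 ?ltW.
    by rewrite ge0_ler_powR ?invr_ge0 ?nnegrE ?exprn_ge0// ltW.
  - apply: emeasurable_funB => //; apply: measurable_funTS.
    exact: (measurableT_comp (cdf_measurable W)).
  - by move=> s _; rewrite lee_fin expR_ge0.
rewrite -[LHS](addeK _ (isT : (u ^+ l * E)%:E \is a fin_num)) intE.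
rewrite intG ?exprn_gt0 ?powR_gt0 ?divr_gt0// -EFinB.
by congr (_ * _ - _)%:E; rewrite mulrA [_ * l%:R]mulrC.
Qed.
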